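(* For every integer $n \geq 3$ and every graph $H \in \mathcal{F}(n)$, there is $k \in \mathbb{N}$ such that the graph $\square^n K_k$ is $H$-induced-saturated.
   Context: All graphs are finite and simple; $\mathbb{N}=\{1,2,\dots\}$. For graphs $H,G$, write $H \subseteq_I G$ if $G$ contains an induced subgraph isomorphic to $H$. A graph $G$ on at least two vertices is $H$-induced-saturated if $H \not\subseteq_I G$, but $H \subseteq_I G - e$ for every edge $e \in E(G)$ and $H \subseteq_I G + e$ for every edge $e \in E(\overline{G})$ of the complement. $\square^n K_k$ is the Cartesian product of $n$ cliques of order $k$: its vertices are all $n$-tuples with entries in a fixed $k$-element set, two tuples being adjacent iff they differ in exactly one coordinate. The dimension $\dim(G)$ of a graph $G$ is the smallest integer $n$ such that $G \subseteq_I \square^n K_k$ for some $k \in \mathbb{N}$ (and is infinite if no such $n$ exists). A balanced $p$-legged spider of height $q$ is a union of $p$ paths $L_1,\dots,L_p$, each of length $q$ (i.e. with $q$ edges), that share exactly one vertex $r$, which is an endpoint of each of them, with $V(L_i)\cap V(L_j)=\{r\}$ for all $1 \le i<j \le p$; its vertices of degree $1$ are called leaves. For $n \geq 3$, $\mathcal{F}(n)$ is the class of graphs $H$ that can be obtained as the union $H = F \cup T$ of graphs $F$ and $T$ such that $\dim(F) \leq n-1$, $T$ is a balanced $(n+1)$-legged spider of height $n+2$, and $V(F) \cap V(T) = V'$, where $V'$ is the set of leaves of $T$. *)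

(* Defs.v *)
From mathcomp Require Import all_boot.

Set Implicit Arguments.
Unset Strict Implicit.
Unset Printing Implicit Defensive.

(* Finite simple graphs whose vertices are drawn from an ambient finite type U.
   The vertex set is a subset of U, so that unions of graphs sharing some of
   their vertices, and intersections of vertex sets, are literal. *)
Record graph (U : finType) := Graph {
  vset : {set U};
  eset : {set {set U}};
  esetP : [forall e in eset, (e \subset vset) && (#|e| == 2)]
}.

Section Graphs.
Variable U : finType.
Implicit Types (G F T L : graph U) (A : {set U}) (e : {set U}).

Definition adj G (x y : U) : bool := [set x; y] \in eset G.

Definition degree G (x : U) : nat := #|[set y | adj G x y]|.

Definition compl_eset G : {set {set U}} :=
  [set e : {set U} | (e \subset vset G) && (#|e| == 2)] :\: eset G.

Fact induced_subproof G A :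
  [forall e in [set e : {set U} in eset G | e \subset A],
     (e \subset vset G :&: A) && (#|e| == 2)].
Proof.
apply/forall_inP => e; rewrite inE => /andP[eG eA].
by have /andP[eV e2] := forall_inP (esetP G) e eG; rewrite subsetI eV eA e2.
Qed.

Definition induced G A : graph U := Graph (induced_subproof G A).

Fact del_edge_subproof G e :
  [forall f in eset G :\ e, (f \subset vset G) && (#|f| == 2)].
Proof.
apply/forall_inP => f; rewrite in_setD1 => /andP[_ fG].
exact: (forall_inP (esetP G) f fG).
Qed.

Definition del_edge G e : graph U := Graph (del_edge_subproof G e).

Fact add_edge_subproof G e :
  [forall f in eset G :|: [set e] :&: compl_eset G,
     (f \subset vset G) && (#|f| == 2)].
Proof.
apply/forall_inP => f; rewrite !inE => /orP[fG|/and3P[_ _ fV]] //.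
exact: (forall_inP (esetP G) f fG).
Qed.

(* The intersection with compl_eset G is only there to make this a total
   function: when e is an edge of the complement, the edge set is e |: eset G. *)
Definition add_edge G e : graph U := Graph (add_edge_subproof G e).

Fact gunion_subproof F T :
  [forall e in eset F :|: eset T,
     (e \subset vset F :|: vset T) && (#|e| == 2)].
Proof.
apply/forall_inP => e; rewrite inE => /orP[] eG.
  have /andP[eV e2] := forall_inP (esetP F) e eG.
  by rewrite e2 andbT (subset_trans eV) ?subsetUl.
have /andP[eV e2] := forall_inP (esetP T) e eG.
by rewrite e2 andbT (subset_trans eV) ?subsetUr.
Qed.

Definition gunion F T : graph U := Graph (gunion_subproof F T).

(* L is a path with q edges, one of whose endpoints is r; the pairs in
   zip (r :: s) s are the pairs of consecutive vertices of r :: s. *)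
Definition path_from (r : U) (q : nat) L : Prop :=
  exists s : seq U,
    [/\ size s = q, uniq (r :: s), vset L = [set x in r :: s]
      & eset L = [set [set p.1; p.2] | p in zip (r :: s) s]].

Definition balanced_spider (p q : nat) T : Prop :=
  exists (r : U) (L : 'I_p -> graph U),
    [/\ forall i, path_from r q (L i),
        forall i j : 'I_p, i < j -> vset (L i) :&: vset (L j) = [set r],
        vset T = \bigcup_(i < p) vset (L i)
      & eset T = \bigcup_(i < p) eset (L i)].

Definition leaves T : {set U} := [set x in vset T | degree T x == 1].

End Graphs.

Definition isomorphic (U W : finType) (H : graph U) (G : graph W) : Prop :=
  exists2 f : {x | x \in vset H} -> {y | y \in vset G},
    bijective f
    & forall x y, adj G (val (f x)) (val (f y)) = adj H (val x) (val y).

Definition induced_in (U W : finType) (H : graph U) (G : graph W) : Prop :=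
  exists2 A : {set W}, A \subset vset G & isomorphic H (induced G A).

Definition induced_saturated (U W : finType) (H : graph U) (G : graph W)
  : Prop :=
  [/\ 2 <= #|vset G|,
      ~ induced_in H G,
      forall e, e \in eset G -> induced_in H (del_edge G e)
    & forall e, e \in compl_eset G -> induced_in H (add_edge G e)].

Definition box_eset (n k : nat) : {set {set {ffun 'I_n -> 'I_k}}} :=
  [set [set x; y] | x in [set: {ffun 'I_n -> 'I_k}],
                    y in [set: {ffun 'I_n -> 'I_k}]
                  & #|[set i | x i != y i]| == 1].

Fact box_subproof (n k : nat) :
  [forall e in box_eset n k,
     (e \subset [set: {ffun 'I_n -> 'I_k}]) && (#|e| == 2)].
Proof.
apply/forall_inP => e /imset2P[x y _]; rewrite inE => /andP[_ xy] ->.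
rewrite subsetT cards2; case: (eqVneq x y) xy => // -> /eqP yy.
suff: #|[set i | y i != y i]| = 0 by rewrite yy.
by apply: eq_card0 => i; rewrite inE eqxx.
Qed.

(* The Cartesian product of n cliques of order k. *)
Definition box (n k : nat) : graph {ffun 'I_n -> 'I_k} :=
  Graph (box_subproof n k).

Definition embeds_in_dim (U : finType) (G : graph U) (d : nat) : Prop :=
  exists2 k : nat, 0 < k & induced_in G (box d k).

(* The dimension is a partial function, given by its graph: no d satisfies
   has_dim G d exactly when the dimension of G is infinite. *)
Definition has_dim (U : finType) (G : graph U) (d : nat) : Prop :=
  embeds_in_dim G d /\ forall d', embeds_in_dim G d' -> d <= d'.

Definition dim_le (U : finType) (G : graph U) (m : nat) : Prop :=
  exists2 d, has_dim G d & d <= m.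

Definition spider_class (n : nat) (U : finType) (H : graph U) : Prop :=
  exists F T : graph U,
    [/\ H = gunion F T,
        dim_le F (n - 1),
        balanced_spider (n + 1) (n + 2) T
      & vset F :&: vset T = leaves T].

(* Main.v *)
(** The root of [H] has [n + 1] pairwise nonadjacent neighbours, while the
    neighbourhood of a vertex of the box is a union of [n] cliques, one for each
    direction; so [H] is not induced in the box.

    Changing an edge [xy] makes room for one more independent neighbour.  If
    [xy] is deleted, put the root at a third point of the line through [x] and
    [y], and start two legs with [x] and [y].  If [xy] is added, put the root at
    [x] and let one leg start with [y].  In both cases [d] is a coordinate where
    [x] and [y] differ; [F] is placed in the slice where coordinate [d] has a
    fixed value.  Each leg first moves coordinate [d] to a value of its own, so
    that two vertices of different legs are adjacent only if their other
    coordinates agree.  It then replaces the other coordinates one by one by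
    those of its leaf, except that one "special" coordinate holds a value private
    to the leg until all others have been replaced.  This keeps the legs apart
    and away from [F], and the number of steps is exactly [n + 2]. *)

Require Import Defs.
From mathcomp Require Import all_boot.
From mathcomp Require Import fingroup perm zify.

Set Implicit Arguments.
Unset Strict Implicit.
Unset Printing Implicit Defensive.

(** * Graphs and boxes *)

Section Hamming.
Variables (n : nat) (S : eqType).
Implicit Types c : 'I_n -> S.

Definition hamming c c' := #|[set i | c i != c' i]|.

Lemma hammingC c c' : hamming c c' = hamming c' c.
Proof. by apply: eq_card => i; rewrite !inE eq_sym. Qed.

Lemma hamming_gt0 c c' i : c i != c' i -> 0 < hamming c c'.
Proof. by move=> ci; apply/card_gt0P; exists i; rewrite inE. Qed.

Lemma hamming_gt1 c c' i j :
  i != j -> c i != c' i -> c j != c' j -> 1 < hamming c c'.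
Proof. by move=> ij ci cj; apply/card_gt1P; exists i, j; split; rewrite ?inE. Qed.

Lemma hamming_eq1 c c' i :
  c i != c' i -> (forall j, j != i -> c j = c' j) -> hamming c c' = 1.
Proof.
move=> ci cE; rewrite /hamming (_ : [set _ | _] = [set i]) ?cards1 //.
apply/setP => j; rewrite !inE; case: (eqVneq j i) => [->//|ji].
by rewrite cE ?eqxx.
Qed.

Lemma hamming_eq1P c c' :
  reflect (exists2 i, c i != c' i & forall j, j != i -> c j = c' j)
          (hamming c c' == 1).
Proof.
apply: (iffP idP) => [/cards1P[i ciE]|[i ci cE]]; last first.
  by apply/eqP/(hamming_eq1 ci).
exists i; first by have := set11 i; rewrite -ciE inE.
move=> j ji; apply/eqP; apply: contraNT ji => cj.
by rewrite -in_set1 -ciE inE.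
Qed.

End Hamming.

Lemma eq_hamming n (S S' : eqType) (c c' : 'I_n -> S) (b b' : 'I_n -> S') :
  (forall i, (c i == c' i) = (b i == b' i)) -> hamming c c' = hamming b b'.
Proof. by move=> cb; apply: eq_card => i; rewrite !inE cb. Qed.

Lemma set2_eq (T : finType) (x y u v : T) :
  [set x; y] = [set u; v] -> (x = u /\ y = v) \/ (x = v /\ y = u).
Proof.
move=> E.
have := set22 u v; have := set21 u v; rewrite -{1 2}E.
have := set22 x y; have := set21 x y; rewrite {1 2}E !in_set2.
by do 4![case/orP=> /eqP ?]; subst; auto.
Qed.

Lemma adj_box n k (x y : {ffun 'I_n -> 'I_k}) :
  adj (box n k) x y = (hamming x y == 1).
Proof.
rewrite /adj /=; apply/imset2P/idP => [[u v _]|xy]; last first.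
  by exists x y; rewrite ?inE.
rewrite inE => /andP[_ uv] /set2_eq[[-> ->]//|[-> ->]].
by rewrite hammingC.
Qed.

Lemma adj_sym (U : finType) (G : graph U) x y : adj G x y = adj G y x.
Proof. by rewrite /adj setUC. Qed.

Lemma adj_irr (U : finType) (G : graph U) x : adj G x x = false.
Proof.
apply/negP => xx; have /andP[_] := forall_inP (esetP G) _ xx.
by rewrite setUid cards1.
Qed.

Lemma adj_vset (U : finType) (G : graph U) x y :
  adj G x y -> x \in vset G /\ y \in vset G.
Proof.
move=> xy; have /andP[/subsetP sub _] := forall_inP (esetP G) _ xy.
by split; apply: sub; rewrite !inE eqxx ?orbT.
Qed.

Lemma induced_inP (U W : finType) (H : graph U) (G : graph W) (f : U -> W) :
  {in vset H &, injective f} -> (forall x, x \in vset H -> f x \in vset G) ->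
  {in vset H &, forall x y, adj G (f x) (f y) = adj H x y} ->
  induced_in H G.
Proof.
move=> f_inj fG f_adj; pose A := f @: vset H.
have sAG : A \subset vset G by apply/subsetP => _ /imsetP[x xH ->]; apply: fG.
exists A => //.
have fA (x : {x | x \in vset H}) : f (val x) \in vset (induced G A).
  by rewrite inE fG ?(valP x) // imset_f ?(valP x).
exists (fun x => exist _ (f (val x)) (fA x)).
  apply: inj_card_bij => [x y [] /f_inj E|].
    by apply: val_inj; apply: E; apply: valP.
  rewrite !card_sig.
  have -> : #|[pred y | y \in vset (induced G A)]| = #|A|.
    by rewrite -[in RHS](setIidPr sAG); apply: eq_card.
  by rewrite -(card_in_imset f_inj); apply: subset_leq_card; apply/subsetP.
move=> x y /=; rewrite -f_adj ?(valP x) ?(valP y) //.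
rewrite /adj inE; case: (_ \in eset G) => //=.
by apply/subsetP => z; rewrite !inE => /orP[]/eqP->; apply: imset_f; apply: valP.
Qed.

Lemma induced_in_map (U W : finType) (H : graph U) (G : graph W) (x0 : U) :
  x0 \in vset H -> induced_in H G ->
  exists2 f : U -> W, {in vset H &, injective f}
    & {in vset H &, forall x y, adj G (f x) (f y) = adj H x y}.
Proof.
move=> x0H [A sAG [h h_bij h_adj]].
(* The vertex [x0] is the default of [insubd]: outside [vset H], [f] takes the image of [x0]. *)
pose f x : W := val (h (insubd (exist _ x0 x0H) x)).
exists f => x y xH yH; rewrite /f.
  move/val_inj/(bij_inj h_bij)/(congr1 val).
  by rewrite !val_insubd xH yH.
have := h_adj (insubd (exist _ x0 x0H) x) (insubd (exist _ x0 x0H) y).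
rewrite !val_insubd xH yH => <-.
rewrite /adj inE; case: (_ \in eset G) => //=; apply/esym/subsetP => z.
by rewrite !inE => /orP[]/eqP->;
  [have := valP (h (insubd (exist _ x0 x0H) x))
  |have := valP (h (insubd (exist _ x0 x0H) y))]; rewrite inE => /andP[].
Qed.

(** By induction, compose with the transposition of [s u] and [v], which fixes the values already
    placed. It later serves to choose, in each coordinate, which element of the clique a label
    stands for. *)
Lemma perm_extension (T : finType) (us vs : seq T) :
  size us = size vs -> uniq us -> uniq vs ->
  exists s : {perm T}, map s us = vs.
Proof.
elim: us vs => [|u us IH] [|v vs] //=; first by exists 1%g.
move=> [szE] /andP[uus uniq_us] /andP[vvs uniq_vs].
have [s sE] := IH _ szE uniq_us uniq_vs.
exists (s * tperm (s u) v)%g; rewrite permM tpermL; congr (_ :: _).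
rewrite -[RHS]sE; apply/eq_in_map => w wus; rewrite permM tpermD //.
  by rewrite (inj_eq perm_inj); apply: contraNneq uus => ->.
by apply: contraNneq vvs => ->; rewrite -sE map_f.
Qed.

(** * Spiders *)

Lemma mem_zip_consecutive (T : eqType) (r : T) s (a b : T) :
  (a, b) \in zip (r :: s) s <->
  exists m, [/\ m < size s, a = nth r (r :: s) m & b = nth r (r :: s) m.+1].
Proof.
have sz : size (zip (r :: s) s) = size s.
  by rewrite size_zip /= (minn_idPr (leqnSn _)).
split=> [/(nthP (r, r))[m]|[m [ms -> ->]]].
  by rewrite sz => ms; rewrite nth_zip_cond sz ms => -[<- <-]; exists m.
apply/(nthP (r, r)); exists m; rewrite ?sz //.
by rewrite nth_zip_cond sz ms.
Qed.

(** [V l m] is the vertex at distance [m] from the root on leg [l]; the legs coincide only at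
    [m = 0]. *)
Record legs (U : finType) (p q : nat) (T : graph U) (V : 'I_p -> nat -> U)
    : Prop := Legs {
  legs_root l l' : V l 0 = V l' 0;
  legs_inj l l' m m' : m <= q -> m' <= q -> V l m = V l' m' ->
    m = m' /\ (l = l' \/ m = 0);
  legs_vset x : x \in vset T <-> exists l m, m <= q /\ x = V l m;
  legs_adj x y : adj T x y <-> exists l m, m < q /\
    ((x = V l m /\ y = V l m.+1) \/ (x = V l m.+1 /\ y = V l m))
}.

Lemma balanced_spider_legs (U : finType) p q (T : graph U) :
  balanced_spider p q T -> exists V : 'I_p -> nat -> U, legs q T V.
Proof.
move=> [r [L [L_path L_meet TV TE]]].
have [s sP] := @fin_all_exists _ (fun=> seq U) _ L_path.
have sz l : size (s l) = q by case: (sP l).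
have Lmem l x : (x \in vset (L l)) = (x \in r :: s l).
  by case: (sP l) => _ _ -> _; rewrite inE.
have mem l m : m <= q -> nth r (r :: s l) m \in vset (L l).
  by move=> mq; rewrite Lmem mem_nth //= ltnS sz.
exists (fun l m => nth r (r :: s l) m); split=> //.
- move=> l l' m m' mq m'q E.
  have uniq_l k : uniq (r :: s k) by case: (sP k).
  case: (eqVneq l l') => [ll'|ll'].
    subst l'; split; last by left.
    by apply/eqP; rewrite -(nth_uniq r _ _ (uniq_l l)) ?E //= ltnS sz.
  (* A vertex on two different legs is the root, which has position 0 on each of them. *)
  have rE : nth r (r :: s l) m = r.
    apply/set1P; case: (ltngtP l l') => [lt|lt|/val_inj ll]; last first.
    + by rewrite ll eqxx in ll'.
    + by rewrite -(L_meet _ _ lt) inE (mem l) // E mem.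
    + by rewrite -(L_meet _ _ lt) inE (mem l) // E mem.
  have z k j : j <= q -> nth r (r :: s k) j = r -> j = 0.
    move=> jq jr; apply/eqP; rewrite -(nth_uniq r _ _ (uniq_l k)) ?jr //=.
    by rewrite ltnS sz.
  have m0 := z _ _ mq rE; rewrite E in rE; have m'0 := z _ _ m'q rE.
  by subst; split; last right.
- move=> x; rewrite TV; split=> [/bigcupP[l _]|[l [m [mq ->]]]].
    rewrite Lmem => /(nthP r)[m]; rewrite /= ltnS sz => mq <-.
    by exists l, m.
  by apply/bigcupP; exists l => //; apply: mem.
- move=> x y; rewrite /adj TE; split=> [/bigcupP|].
    move=> [l _]; have [_ _ _ ->] := sP l => /imsetP[[a b] /=].
    move=> /mem_zip_consecutive[m []]; rewrite sz => mq -> -> /set2_eq E.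
    by exists l, m.
  move=> [l [m [mq E]]]; apply/bigcupP; exists l => //; have [_ _ _ ->] := sP l.
  apply/imsetP; exists (nth r (r :: s l) m, nth r (r :: s l) m.+1).
    by apply/mem_zip_consecutive; exists m; rewrite sz.
  by case: E => -[-> ->] //=; rewrite setUC.
Qed.

(** The end of a leg has its predecessor as only neighbour. An inner vertex has a neighbour on
    either side, and the root has one on each of at least two legs. *)
Lemma legs_leaves (U : finType) p q (T : graph U) (V : 'I_p -> nat -> U) l m :
  legs q T V -> 1 < p -> 1 < q -> m <= q -> (V l m \in leaves T) = (m == q).
Proof.
move=> [V0 Vinj Vv VaE] p1 q1 mq; rewrite inE.
have Va x y := equivP (@idP (adj T x y)) (VaE x y).
have -> /= : V l m \in vset T by apply/Vv; exists l, m.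
have deg2 y z : adj T (V l m) y -> adj T (V l m) z -> y <> z ->
    (degree T (V l m) == 1) = false.
  move=> my mz /eqP yz; rewrite gtn_eqF //; apply/card_gt1P.
  by exists y, z; rewrite !inE.
case: (ltngtP m q) mq => // [lt_mq|->] _; last first.
  apply/eqP; rewrite /degree -(cards1 (V l q.-1)); congr #|pred_of_set _|.
  apply/setP => y; rewrite !inE; apply/Va/eqP.
    move=> [l' [m' [m'q [[E ->]|[E ->]]]]].
      by have [] := Vinj _ _ _ _ _ _ E; lia.
    have [||qE O] := Vinj _ _ _ _ _ _ E; [lia|lia|].
  by move: O => [->|]; [rewrite qE | lia].
  move=> ->; exists l, q.-1; split; first lia.
  by right; rewrite prednK //; lia.
case: (posnP m) => [m0|m_gt0].
  subst m; have [l' l'l] : exists l', l' != l.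
    have [->|n0] := eqVneq l (Ordinal (ltnW p1)).
      by exists (Ordinal p1).
    by exists (Ordinal (ltnW p1)); rewrite eq_sym.
  apply: (deg2 (V l 1) (V l' 1)).
  - by apply/Va; exists l, 0; split; [lia | left].
  - by apply/Va; exists l', 0; split; [lia | left; rewrite (V0 l' l)].
  move=> E; have [||_ O] := Vinj _ _ _ _ _ _ E; [lia|lia|].
  by move: O => [ll|//]; rewrite ll eqxx in l'l.
apply: (deg2 (V l m.-1) (V l m.+1)).
- by apply/Va; exists l, m.-1; split; [lia | right; rewrite prednK].
- by apply/Va; exists l, m; split; [lia | left].
by move=> E; have [] := Vinj _ _ _ _ _ _ E; lia.
Qed.

(** The working description of [H]: the spider is absorbed into [V], and adjacency is listed by the
    positions of the two vertices. As [V l 0] is the same for all [l], [so_adjV] also covers the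
    root against any leg. *)
Record spider_on (n : nat) (U : finType) (H F : graph U)
    (V : 'I_(n + 1) -> nat -> U) : Prop := SpiderOn {
  so_root l l' : V l 0 = V l' 0;
  so_inj l l' m m' : m <= n + 2 -> m' <= n + 2 -> V l m = V l' m' ->
    m = m' /\ (l = l' \/ m = 0);
  so_leaf l m : m <= n + 2 -> (V l m \in vset F) = (m == n + 2);
  so_vset x :
    x \in vset H <-> x \in vset F \/ exists l m, m < n + 2 /\ x = V l m;
  so_adjF : {in vset F &, forall x y, adj H x y = adj F x y};
  so_adjVF l m x : m < n + 2 -> x \in vset F ->
    adj H (V l m) x = (m == n + 1) && (x == V l (n + 2));
  so_adjV l m m' : m <= n + 2 -> m' <= n + 2 -> m < m' ->
    adj H (V l m) (V l m') = (m' == m.+1);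
  so_adjVV l l' m m' : l != l' -> 0 < m < n + 2 -> 0 < m' < n + 2 ->
    adj H (V l m) (V l' m') = false
}.

(** Every edge of the spider has an end that is not a leaf and so lies outside [F]. Hence the spider
    adds no edge inside [F], and [F] has no edge at a non-leaf of the spider. *)
Lemma spider_class_spider_on n (U : finType) (H : graph U) :
  0 < n -> spider_class n H ->
  exists F V, dim_le F (n - 1) /\ @spider_on n U H F V.
Proof.
move=> n0 [F [T [HE dimF /balanced_spider_legs[V VP] FT]]].
exists F, V; split=> //.
have [V0 Vinj Vv VaE] := VP.
have Va x y := equivP (@idP (adj T x y)) (VaE x y).
have leaf l m : m <= n + 2 -> (V l m \in vset F) = (m == n + 2).
  move=> mn; rewrite -(legs_leaves l VP) -?FT ?inE; [|lia..].
  have -> : V l m \in vset T by apply/Vv; exists l, m.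
  by rewrite andbT.
have adjH x y : adj H x y = adj F x y || adj T x y.
  by rewrite HE /adj inE.
have adjFl l m x : m < n + 2 -> adj F (V l m) x = false.
  move=> mn; apply/negP => /adj_vset[]; rewrite leaf; lia.
split=> //.
- move=> x; rewrite HE inE; split=> [/orP|] [xF|xT]; [by left| |by rewrite xF|].
    have [l [m [mn xE]]] := (Vv _).1 xT; rewrite leq_eqVlt in mn.
    case/orP: mn => [/eqP mn|mn]; last by right; exists l, m.
    by left; rewrite xE leaf mn.
  have [l [m [mn ->]]] := xT; apply/orP; right.
  by apply/Vv; exists l, m; rewrite ltnW.
- move=> x y xF yF; rewrite adjH; case: (boolP (adj T x y)); rewrite ?orbF //.
  case/Va => l [m [mn [[xE _]|[_ yE]]]].
    by move: xF; rewrite xE leaf; lia.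
  by move: yF; rewrite yE leaf; lia.
- move=> l m x mn xF; rewrite adjH adjFl //=; apply/Va/andP.
    move=> [l' [m' [m'n [[E xE]|[_ xE]]]]]; last first.
      by move: xF; rewrite xE leaf; lia.
    move: xF; rewrite xE leaf // => /eqP m'E.
    have [||mm' O] := Vinj _ _ _ _ _ _ E; [lia|lia|].
    case: O => [ll|]; last by lia.
    by rewrite -ll m'E; split; [lia | rewrite eqxx].
  move=> [/eqP mE /eqP ->]; exists l, m; split; first lia.
  by left; rewrite mE -addnS.
- move=> l m m' mn m'n mm'; rewrite adjH adjFl; last lia.
  apply/Va/eqP => [[l' [k [kn [[E E']|[E E']]]]]|->].
  + have [||mk _] := Vinj _ _ _ _ _ _ E; [lia|lia|].
    by have [] := Vinj _ _ _ _ _ _ E'; lia.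
  + have [||mk _] := Vinj _ _ _ _ _ _ E; [lia|lia|].
    by have [] := Vinj _ _ _ _ _ _ E'; lia.
  by exists l, m; split; [lia | left].
- move=> l l' m m' ll' mn m'n; rewrite adjH adjFl; last lia.
  apply/Va => [[k [j [jn E]]]].
  have [a [b [aj bj [aE bE]]]] : exists a b,
      [/\ a <= n + 2, b <= n + 2 & V l m = V k a /\ V l' m' = V k b].
    by case: E => -[-> ->]; [exists j, j.+1 | exists j.+1, j]; split=> //; lia.
  have [||_ [lk|]] := Vinj _ _ _ _ _ _ aE; try lia.
  have [||_ [l'k|]] := Vinj _ _ _ _ _ _ bE; try lia.
  by rewrite lk l'k eqxx in ll'.
Qed.

Lemma not_induced_in_box n k (U : finType) (H F : graph U) V :
  0 < n -> @spider_on n U H F V -> ~ induced_in H (box n k).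
Proof.
move=> n0 HV; pose l0 : 'I_(n + 1) := cast_ord (esym (addn1 n)) ord0.
have VH l m : m < n + 2 -> V l m \in vset H.
  by move=> mn; apply/(so_vset HV); right; exists l, m.
case/(induced_in_map (VH l0 0 ltac:(lia))) => f f_inj f_adj.
have dirP (l : 'I_(n + 1)) : exists i, f (V l0 0) i != f (V l 1) i /\
    forall j, j != i -> f (V l0 0) j = f (V l 1) j.
  have : adj (box n k) (f (V l0 0)) (f (V l 1)).
    by rewrite f_adj ?VH ?(so_root HV l0 l) ?(so_adjV HV) //; lia.
  by rewrite adj_box => /hamming_eq1P[i fi fj]; exists i.
have [dir dirE] := fin_all_exists dirP.
(* There are [n + 1] legs for [n] directions; two legs starting in the same direction would have
   adjacent first vertices. *)
have : ~~ injectiveb dir.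
  apply/negP => /injectiveP/leq_card; rewrite !card_ord; lia.
case/injectivePn => l [l' ll' dd].
have : adj (box n k) (f (V l 1)) (f (V l' 1)).
  have neq : f (V l 1) != f (V l' 1).
    apply: contraNneq ll' => /f_inj E.
    have V1 : V l 1 = V l' 1 by apply: E; apply: VH; lia.
    by have [||_ [->|]] := so_inj HV _ _ V1; rewrite ?eqxx; lia.
  have out j : j != dir l -> f (V l 1) j = f (V l' 1) j.
    by move=> jd; rewrite -(dirE l).2 // -(dirE l').2 // -dd.
  rewrite adj_box (@hamming_eq1 _ _ _ _ (dir l)) //.
  apply: contraNneq neq => E; apply/eqP/ffunP => j.
  by case: (eqVneq j (dir l)) => [->|/out].
by rewrite f_adj ?VH ?(so_adjVV HV) //; lia.
Qed.

(** * Placing the spider *)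

(** The at most [n - 1] coordinates of an embedding of [F] are moved by [lift d] to positions other
    than [d], and all other positions hold 0, so Hamming distances are kept. The bound [k] comes
    before [d] because the box is chosen before the edge. *)
Lemma dim_le_coords n (U : finType) (F : graph U) x0 :
  0 < n -> x0 \in vset F -> dim_le F (n - 1) ->
  exists k, forall d : 'I_n, exists g : U -> 'I_n -> nat,
  [/\ forall x i, g x i <= k, forall x, g x d = 0 &
      {in vset F &, forall x y, x <> y ->
        0 < hamming (g x) (g y) /\ (hamming (g x) (g y) == 1) = adj F x y}].
Proof.
move=> n0 x0F [d' [[k k0 /(induced_in_map x0F)[e e_inj e_adj] _]] d'n].
exists k => d.
have d'n1 : d' <= n.-1 by rewrite -subn1.
pose h j := lift d (widen_ord d'n1 j).
have h_inj : injective h.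
  by move=> j j' /lift_inj/(congr1 val)/= jj; apply: val_inj.
pose g x i := if unlift d i is Some j then
  if insub (j : nat) is Some j' then (e x (j' : 'I_d') : nat) else 0 else 0.
have gh x j : g x (h j) = e x j.
  rewrite /g liftK; case: insubP => [j' _ /= jj|/=].
    by congr (nat_of_ord (e x _)); apply: val_inj.
  by rewrite ltn_ord.
have gE x y : hamming (g x) (g y) = hamming (e x) (e y).
  rewrite /hamming -(card_imset _ h_inj); apply: eq_card => i.
  apply/idP/imsetP => [|[j]]; rewrite !inE; last by move=> ej ->; rewrite !gh.
  case: (unliftP d i) => [j ->|->]; last by rewrite /g unlift_none eqxx.
  rewrite {1 2}/g liftK; case: insubP => [j' _ /= jj|_]; last by rewrite eqxx.
  move=> exy; exists j'; first by rewrite inE.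
  by congr (lift _ _); apply: val_inj; rewrite /= jj.
exists g; split=> [x i|x|x y xF yF xy].
- rewrite /g; case: unlift => // j; case: insubP => // j' _ _.
  exact/ltnW/ltn_ord.
- by rewrite /g unlift_none.
rewrite gE; split; last by rewrite -adj_box e_adj.
rewrite card_gt0; apply: contra_notN xy => /eqP E.
apply: e_inj => //; apply/ffunP => i; apply/eqP.
by have := in_set0 i; rewrite -E inE => /negbFE.
Qed.

(** * The order in which a leg replaces its coordinates *)

Section Times.
Variables (n : nat) (d s : 'I_n).
Hypothesis sd : s != d.

(* When coordinate [i] of a leg with special coordinate [s] takes the value of
   the leaf. *)
Definition switch_time (i : 'I_n) : nat :=
  if i == s then n.+1
  else 3 + index i [seq j <- enum 'I_n | (j != d) && (j != s)].

Let rest := [seq j <- enum 'I_n | (j != d) && (j != s)].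

Let mem_rest i : (i \in rest) = (i != d) && (i != s).
Proof. by rewrite mem_filter mem_enum andbT. Qed.

Let size_rest : (size rest).+2 = n.
Proof.
have -> : size rest = #|predC (pred2 d s)|.
  rewrite /rest enumT cardE /enum_mem !size_filter.
  by apply: eq_count => i; rewrite !inE negb_or.
by have := cardC (pred2 d s); rewrite card_ord card2 eq_sym sd.
Qed.

Lemma switch_time_last : switch_time s = n.+1.
Proof. by rewrite /switch_time eqxx. Qed.

Lemma switch_time_bounds i : i != d -> i != s -> 3 <= switch_time i <= n.
Proof.
move=> id is_; rewrite /switch_time (negbTE is_).
have : index i rest < size rest by rewrite index_mem mem_rest id.
by have := size_rest; rewrite -/rest; lia.
Qed.

(** Positions in a duplicate-free list are distinct, and [s] comes after all of them. With
    [switch_time_surj], each time from 3 to [n + 1] belongs to exactly one coordinate other than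
    [d]. *)
Lemma switch_time_inj i j :
  i != d -> j != d -> switch_time i = switch_time j -> i = j.
Proof.
move=> id jd; have := switch_time_bounds id; have := switch_time_bounds jd.
case: (eqVneq i s) => [->|is_]; case: (eqVneq j s) => [->|js_] //=.
- by rewrite switch_time_last => /(_ isT); lia.
- by rewrite switch_time_last => _ /(_ isT); lia.
move=> _ _; rewrite /switch_time (negbTE is_) (negbTE js_) -/rest => /addnI E.
have irest : i \in rest by rewrite mem_rest id.
have jrest : j \in rest by rewrite mem_rest jd.
by rewrite -(nth_index s irest) E nth_index.
Qed.

Lemma switch_time_surj m :
  3 <= m <= n.+1 -> exists2 i, i != d & switch_time i = m.
Proof.
move=> mn; case: (eqVneq m n.+1) => [->|m_n].
  by exists s => //; exact: switch_time_last.
have ms : m - 3 < size rest by have := size_rest; lia.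
have := mem_nth s ms; rewrite mem_rest => /andP[id is_].
exists (nth s rest (m - 3)) => //; rewrite /switch_time (negbTE is_) -/rest.
rewrite index_uniq //; first lia.
exact/filter_uniq/enum_uniq.
Qed.

End Times.

(** * Labels of the vertices of [H] *)

Section Codes.
Variables (n k : nat) (U : finType) (H F : graph U).
Variables (V : 'I_(n + 1) -> nat -> U) (d s : 'I_n) (D : pred 'I_n).
Variable (g : U -> 'I_n -> nat).
Hypotheses (n3 : 3 <= n) (HV : spider_on H F V) (sd : s != d).
Hypothesis Ds : forall i, D i -> D s.
Hypotheses (g_le : forall x i, g x i <= k) (g_d : forall x, g x d = 0).
Hypothesis g_adj : {in vset F &, forall x y, x <> y ->
  0 < hamming (g x) (g y) /\ (hamming (g x) (g y) == 1) = adj F x y}.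
Implicit Types (l : 'I_(n + 1)) (i : 'I_n) (m : nat) (x y : U).

(* The legs that leave the root in direction [d], or through [y] when [xy] is
   added: they have coordinate [d] set from the first step on and spend the
   second step on the special coordinate; the other legs do it the other way
   round. *)
Definition spiral l : bool := (l == d :> nat) || (l == n :> nat).

(** Legs other than [d] and [n] take the coordinate of their own index, so they leave the root in
    pairwise different directions, none of them [d]. For leg [n] the [insub] fails, and it gets [s]
    like leg [d]. *)
Definition special l : 'I_n :=
  if insub (l : nat) is Some i then if i == d then s else i else s.

Definition time_d l := if spiral l then 1 else 2.
Definition time_special l := if spiral l then 2 else 1.
Notation t l := (switch_time d (special l)).

(* Labels: 0 for the root, 1 for the slice of [F] and, away from [d], for the
   coordinates of [y] when [xy] is added, [l + 2] for the private values of leg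
   [l], and from [n + 3] on for the coordinates of [F].  The set [D] of the
   coordinates where [x] and [y] differ is used in the case of an added edge
   only, and is taken empty for a deleted edge. *)
Definition leg_code l m i : nat :=
  if i == d then (if m < time_d l then 0 else if m < n + 2 then l + 2 else 1)
  else if t l i <= m then n + 3 + g (V l (n + 2)) i
  else if (i == special l) && (time_special l <= m) then l + 2
  else [&& 0 < m, l == n :> nat & D i].

Definition F_code x i : nat := if i == d then 1 else n + 3 + g x i.

Lemma special_neq_d l : special l != d.
Proof. by rewrite /special; case: insubP => // i _ _; case: ifP => // ->. Qed.

Lemma special_inj l l' :
  ~~ spiral l -> ~~ spiral l' -> special l = special l' -> l = l'.
Proof.
have sE k' : ~~ spiral k' -> special k' = k' :> nat.
  rewrite /spiral /special negb_or => /andP[kd kn].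
  case: insubP => [i _ /= ik|]; last by have := ltn_ord k'; lia.
  by case: eqP => // id; rewrite -ik id eqxx in kd.
by move=> /sE l1 /sE l2 E; apply: val_inj; rewrite /= -l1 -l2 E.
Qed.

Lemma t_special l : t l (special l) = n.+1.
Proof. exact: switch_time_last. Qed.

Lemma t_bounds l i : i != d -> 3 <= t l i <= n.+1.
Proof.
move=> id; case: (eqVneq i (special l)) => [->|is_].
  by rewrite t_special; lia.
by have := switch_time_bounds (special_neq_d l) id is_; lia.
Qed.

(** The schedule of the step from position [m - 1] to [m]. It leaves out the jump of the coordinates
    in [D] at the first step of leg [n]. *)
Definition changes l m i : bool :=
  if i == d then (m == time_d l) || (m == n + 2)
  else (m == t l i) || (i == special l) && (m == time_special l).

Lemma time_cases l :
  (time_d l = 1 /\ time_special l = 2) \/ (time_d l = 2 /\ time_special l = 1).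
Proof. by rewrite /time_d /time_special; case: ifP; auto. Qed.

Lemma leg_code_d l m :
  leg_code l m d = if m < time_d l then 0 else if m < n + 2 then l + 2 else 1.
Proof. by rewrite /leg_code eqxx. Qed.

Lemma leg_code_late l m i :
  i != d -> t l i <= m -> leg_code l m i = n + 3 + g (V l (n + 2)) i.
Proof. by move=> id tm; rewrite /leg_code (negbTE id) tm. Qed.

Lemma leg_code_special l m :
  time_special l <= m <= n -> leg_code l m (special l) = l + 2.
Proof.
move=> /andP[tm mn]; rewrite /leg_code (negbTE (special_neq_d l)) t_special.
by rewrite ltnNge mn eqxx tm.
Qed.

Lemma leg_code_early l m i :
  i != d -> m < t l i -> (i = special l -> m < time_special l) ->
  leg_code l m i = [&& 0 < m, l == n :> nat & D i].
Proof.
move=> id tm im; rewrite /leg_code (negbTE id) leqNgt tm /=.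
by case: (eqVneq i (special l)) => //= /im; rewrite ltnNge => /negbTE->.
Qed.

(** Old values never return. Coordinate [d] passes through 0, [l + 2], 1; any other starts at most
    1, possibly moves to the private label [l + 2], which is at most [n + 2], and ends at [n + 3] or
    more. *)
Lemma changes_neq l m m' m'' i :
  changes l m' i -> m < m' -> m' <= m'' <= n + 2 ->
  leg_code l m i != leg_code l m'' i.
Proof.
rewrite /changes; case: (eqVneq i d) => [->|id] ch mm' m'm''.
  rewrite !leg_code_d; case: (time_cases l) ch => -[-> _] ch;
  by do ?[case: ifP => ?]; lia.
have t_i := t_bounds l id.
have early : m < t l i -> (i = special l -> m < time_special l) ->
    leg_code l m i <= 1.
  by move=> ? ?; rewrite leg_code_early //; case: [&& _, _ & _].
have ln := ltn_ord l.
case/orP: ch => [/eqP m't|/andP[/eqP iE /eqP m't]].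
  rewrite [leg_code l m'' i]leg_code_late //; last lia.
  case: (eqVneq i (special l)) => [iE|is_]; last first.
    suff : leg_code l m i <= 1 by lia.
    by apply: early => [|/eqP]; rewrite ?(negbTE is_) //; lia.
  rewrite iE t_special in m't; case: (leqP (time_special l) m) => tm.
    by rewrite iE leg_code_special; lia.
  suff : leg_code l m i <= 1 by lia.
  by apply: early; rewrite // iE t_special; lia.
have m1 : leg_code l m i <= 1.
  by apply: early; [case: (time_cases l); lia | lia].
case: (leqP m'' n) => m''n; last by rewrite [leg_code l m'' i]leg_code_late //; lia.
by rewrite [in X in _ != X]iE leg_code_special; lia.
Qed.

Lemma changes_eq l m i :
  0 < m <= n + 2 -> ~~ changes l m i -> (l = n :> nat -> m = 1 -> ~~ D i) ->
  leg_code l m.-1 i = leg_code l m i.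
Proof.
rewrite /changes; case: (eqVneq i d) => [->|id] mn ch DD.
  rewrite !leg_code_d; case: (time_cases l) ch => -[-> _] ch;
  by do ?[case: ifP => ?]; lia.
have t_i := t_bounds l id.
case: (leqP (t l i) m.-1) => tm; first by rewrite !leg_code_late //; lia.
have tm1 : m < t l i by lia.
case: (eqVneq i (special l)) ch => [iE|is_] /= ch.
  rewrite iE t_special in tm1 *.
  case: (leqP (time_special l) m.-1) => tsm; first by rewrite !leg_code_special //; lia.
  rewrite !leg_code_early // ?t_special -?iE //; try (case: (time_cases l); lia).
have no A : i = special l -> A by move=> iE; rewrite iE eqxx in is_.
rewrite !leg_code_early //; try exact: no.
case: eqP => [ln|]; last by rewrite !andbF.
have -> : 0 < m by lia.
case: (posnP m.-1) => // m1; rewrite (negbTE (DD ln _)) //; lia.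
Qed.

(** Steps 1 and 2 belong to [d] and the special coordinate in some order, steps 3 to [n + 1] to the
    coordinates other than [d], and step [n + 2] to [d] again. *)
Lemma changes_ex l m : 0 < m <= n + 2 -> exists i, changes l m i.
Proof.
move=> mn; rewrite /changes.
case: (boolP ((m == time_d l) || (m == n + 2))) => md.
  by exists d; rewrite eqxx.
case: (eqVneq m (time_special l)) => ms.
  by exists (special l); rewrite (negbTE (special_neq_d l)) eqxx orbT.
have m3 : 3 <= m <= n.+1.
  by move: md ms; case: (time_cases l) => -[-> ->]; lia.
have [i id tm] := switch_time_surj (special_neq_d l) m3.
by exists i; rewrite (negbTE id) tm eqxx.
Qed.

Lemma changes_uniq l m i j :
  changes l m i -> changes l m j -> i = j.
Proof.
rewrite /changes; case: (eqVneq i d) => [->|id]; case: (eqVneq j d) => [->|jd] //.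
- have := t_bounds l jd.
  have : j == special l -> t l j = n.+1 by move/eqP->; exact: t_special.
  by case: (time_cases l) => -[-> ->]; lia.
- have := t_bounds l id.
  have : i == special l -> t l i = n.+1 by move/eqP->; exact: t_special.
  by case: (time_cases l) => -[-> ->]; lia.
have ti := t_bounds l id; have tj := t_bounds l jd.
case/orP=> [/eqP mi|/andP[/eqP -> /eqP mi]];
  case/orP=> [/eqP mj|/andP[/eqP -> /eqP mj]] //.
- by apply: (switch_time_inj (special_neq_d l)); rewrite // -mi.
- by case: (time_cases l); lia.
- by case: (time_cases l); lia.
Qed.

(** Only [d] and the special coordinate change twice: first by step 2, then at step [n + 2] or
    [n + 1] respectively. These are not consecutive since [n >= 3]. *)
Lemma changes_consecutive l m i j :
  changes l m i -> changes l m.+1 j -> i != j.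
Proof.
move=> ci cj; apply: contraTneq ci => ->; move: cj; rewrite /changes.
case: (eqVneq j d) => [_|jd]; first by case: (time_cases l); lia.
have := t_bounds l jd.
have : j == special l -> t l j = n.+1 by move/eqP->; exact: t_special.
by case: (time_cases l) => -[_ ->]; lia.
Qed.

(** * Distances between labels: within a leg, inside [F], and between different pieces *)

Lemma leg_code_gt0 l m m' :
  m < m' <= n + 2 -> 0 < hamming (leg_code l m) (leg_code l m').
Proof.
move=> /andP[mm' m'n]; have [|i ci] := @changes_ex l m'; first lia.
by apply: (@hamming_gt0 _ _ _ _ i); apply: changes_neq ci _ _; lia.
Qed.

Lemma leg_code_adj l m m' :
  m < m' <= n + 2 -> ~~ [&& D s, l == n :> nat, m == 0 & m' == 1] ->
  (hamming (leg_code l m) (leg_code l m') == 1) = (m' == m.+1).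
Proof.
move=> /andP[mm' m'n] nspec; have [|i ci] := @changes_ex l m.+1; first lia.
case: (m' =P m.+1) => [m'E|m'E].
  subst m'; apply/eqP/(hamming_eq1 (i := i)) => [|j ji].
    by apply: changes_neq ci _ _; lia.
  apply: (@changes_eq l m.+1) => //.
    by apply: contraNN ji => cj; rewrite (changes_uniq cj ci).
  move=> ln [m0]; apply: contraNN nspec => /Ds ->; rewrite ln m0; lia.
(* Positions at least two apart: the coordinates changed at steps [m + 1] and [m + 2] are distinct,
   and both still differ at [m']. *)
have [|j cj] := @changes_ex l m.+2; first lia.
apply: gtn_eqF; apply: (hamming_gt1 (changes_consecutive ci cj)).
  by apply: changes_neq ci _ _; lia.
by apply: changes_neq cj _ _; lia.
Qed.

Lemma F_code_adj : {in vset F &, forall x y, x <> y ->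
  0 < hamming (F_code x) (F_code y) /\
  (hamming (F_code x) (F_code y) == 1) = adj F x y}.
Proof.
move=> x y xF yF xy; rewrite (@eq_hamming _ _ _ _ _ (g x) (g y)).
  exact: g_adj.
move=> i; rewrite /F_code; case: (i =P d) => [->|]; first by rewrite !g_d.
by move=> _; rewrite eqn_add2l.
Qed.

Lemma leg_code_end l i : leg_code l (n + 2) i = F_code (V l (n + 2)) i.
Proof.
rewrite /F_code; case: eqP => [->|/eqP id].
  by rewrite leg_code_d ltnn; case: (time_cases l) => -[-> _]; case: ltnP; lia.
by rewrite leg_code_late //; have := t_bounds l id; lia.
Qed.

Lemma leaf_F l : V l (n + 2) \in vset F.
Proof. by rewrite (so_leaf HV). Qed.

Lemma g_neq x y : x \in vset F -> y \in vset F -> x <> y ->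
  exists2 i, i != d & g x i != g y i.
Proof.
move=> xF yF xy; have [/card_gt0P[i]] := g_adj xF yF xy.
rewrite inE => gi _; exists i => //; apply: contraNneq gi => ->.
by rewrite !g_d.
Qed.

(** Before the leaf, coordinate [d] is outside the slice of [F]. A second difference is the special
    coordinate up to position [n]; at position [n + 1] the other coordinates are those of the leaf,
    which differs from [x]. *)
Lemma leg_code_F l m x :
  m < n + 2 -> x \in vset F -> x <> V l (n + 2) ->
  1 < hamming (leg_code l m) (F_code x).
Proof.
move=> mn xF xl.
have neq_d : leg_code l m d != F_code x d.
  by rewrite leg_code_d /F_code eqxx mn; case: ltnP => //; lia.
suff [i id neq_i] : exists2 i, i != d & leg_code l m i != F_code x i.
  exact: hamming_gt1 id neq_i neq_d.
rewrite /F_code; case: (leqP m n) => [m_n|n_m].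
  exists (special l); first exact: special_neq_d.
  rewrite (negbTE (special_neq_d l)); have ln := ltn_ord l.
  case: (leqP (time_special l) m) => tm.
    by rewrite leg_code_special; lia.
  rewrite leg_code_early ?special_neq_d ?t_special //.
  by case: [&& _, _ & _] => /=; lia.
have [i id gi] := g_neq (leaf_F l) xF (nesym xl).
exists i => //; rewrite (negbTE id) leg_code_late ?eqn_add2l //.
by have := t_bounds l id; lia.
Qed.

Lemma leg_code_other l l' m i :
  i != d -> l != l' -> leg_code l m i != l' + 2.
Proof.
move=> id ll'; have := ltn_ord l'; have := ltn_ord l.
have {ll'}: l != l' :> nat by [].
rewrite /leg_code (negbTE id); case: ifP => _; first lia.
by case: ifP => _; [lia | case: [&& _, _ & _] => /=; lia].
Qed.

(** Coordinate [d] separates the legs unless both still have 0 there; a second difference comes from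
    a private label, from distinct leaves, or from [D]. The excluded pair is the ends of the edge to
    be deleted. *)
Lemma leg_code_cross l l' m m' :
  l != l' -> 0 < m < n + 2 -> 0 < m' < n + 2 ->
  ~~ [&& ~~ D s, spiral l, spiral l', m == 1 & m' == 1] ->
  1 < hamming (leg_code l m) (leg_code l' m').
Proof.
move=> ll' mn m'n nspec.
have ll'n : l != l' :> nat by [].
case: (boolP ((m < time_d l) && (m' < time_d l'))) => [/andP[md m'd]|md].
  have [sl m1] : ~~ spiral l /\ m = 1.
    by move: md; rewrite /time_d; case: spiral => //=; lia.
  have [sl' m'1] : ~~ spiral l' /\ m' = 1.
    by move: m'd; rewrite /time_d; case: spiral => //=; lia.
  (* Neither leg has moved in [d], so both are one step from the root, in their distinct special
     directions. *)
  subst m m'; apply: (@hamming_gt1 _ _ _ _ (special l) (special l')).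
  - by apply: contraNneq ll' => /(special_inj sl sl')->.
  - rewrite leg_code_special ?(negbTE sl) /time_special ?(negbTE sl); last lia.
    by rewrite eq_sym leg_code_other ?special_neq_d // eq_sym.
  - rewrite [leg_code l' 1 _]leg_code_special /time_special ?(negbTE sl'); last lia.
    by rewrite leg_code_other ?special_neq_d.
have neq_d : leg_code l m d != leg_code l' m' d.
  rewrite !leg_code_d; move: md; case: ltnP => ? /=; case: ltnP => ? //=;
  by do ?[case: ifP => ?]; lia.
suff [i id neq_i] : exists2 i, i != d & leg_code l m i != leg_code l' m' i.
  exact: hamming_gt1 id neq_i neq_d.
case: (boolP (time_special l <= m <= n)) => ml.
  exists (special l); first exact: special_neq_d.
  by rewrite leg_code_special // eq_sym leg_code_other ?special_neq_d // eq_sym.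
case: (boolP (time_special l' <= m' <= n)) => m'l'.
  exists (special l'); first exact: special_neq_d.
  by rewrite [leg_code l' m' _]leg_code_special // leg_code_other ?special_neq_d.
(* Without its private label in the special coordinate, a vertex is at position [n + 1] and agrees
   with its leaf outside [d], or it is the first on a spiral leg, with labels 0 and 1 only outside
   [d]. *)
have ends k' j : 0 < j < n + 2 -> ~~ (time_special k' <= j <= n) ->
    j = n.+1 \/ [/\ spiral k', j = 1 &
                    forall i, i != d -> leg_code k' 1 i = (k' == n :> nat) && D i].
  rewrite /time_special; case: (boolP (spiral k')) => sk jn jk; last by left; lia.
  case: (eqVneq j 1) => j1; last by left; lia.
  right; split=> // i id; rewrite leg_code_early //.
    by have := t_bounds k' id; lia.
  by rewrite /time_special sk.
have late k' i : i != d -> leg_code k' n.+1 i = n + 3 + g (V k' (n + 2)) i.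
  by move=> id; rewrite leg_code_late //; have := t_bounds k' id; lia.
case: (ends _ _ mn ml) => [->|[sl m1 lE]]; case: (ends _ _ m'n m'l') => [->|[sl' m'1 l'E]].
- have [|i id gi] := @g_neq (V l (n + 2)) (V l' (n + 2)) (leaf_F _) (leaf_F _).
    move/(so_inj HV) => [||_ []//]; rewrite ?leqnn //; last lia.
    by move=> E; rewrite E eqxx in ll'.
  by exists i; rewrite // !late // eqn_add2l.
- exists s; rewrite // late // m'1 l'E //; lia.
- exists s; rewrite // late // m1 lE //; lia.
(* Legs [d] and [n] at their first vertices: in coordinate [s] leg [n] has 1 because [D s] holds,
   and leg [d] has 0. *)
exists s; rewrite // m1 m'1 lE // l'E //.
have -> : D s by move: nspec; rewrite sl sl' m1 m'1 /= andbT negbK.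
move: sl sl'; rewrite /spiral !andbT; lia.
Qed.

(** A leg vertex may be picked under several names only if it is the root, whose label is 0
    everywhere on every leg. The last branch is for elements outside [H]. *)
Definition code x : 'I_n -> nat :=
  if x \in vset F then F_code x
  else if [pick lm : 'I_(n + 1) * 'I_(n + 2) | V lm.1 lm.2 == x] is Some lm
    then leg_code lm.1 lm.2
  else F_code x.

Lemma leg_code_root l i : leg_code l 0 i = 0.
Proof.
case: (eqVneq i d) => [->|id].
  by rewrite leg_code_d; case: (time_cases l) => -[-> _].
rewrite leg_code_early //; first by have := t_bounds l id; lia.
by move=> _; case: (time_cases l) => -[_ ->].
Qed.

Lemma code_F x : x \in vset F -> code x = F_code x.
Proof. by rewrite /code => ->. Qed.

Lemma code_V l m i : m <= n + 2 -> code (V l m) i = leg_code l m i.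
Proof.
move=> mn; rewrite /code (so_leaf HV) //.
case: (eqVneq m (n + 2)) => [->|mE]; first by rewrite -leg_code_end.
case: pickP => [[l' m'] /= /eqP E|none].
  have [||m'm [->|m0]] := so_inj HV _ _ E; rewrite ?m'm //.
    by rewrite ltnW.
  by rewrite -m'm m0 !leg_code_root.
have mn' : m < n + 2 by lia.
by have := none (l, Ordinal mn'); rewrite /= eqxx.
Qed.

Lemma code_le x i : code x i < n + 3 + k.+1.
Proof.
have Fle y : F_code y i < n + 3 + k.+1.
  by rewrite /F_code; have := g_le y i; case: ifP; lia.
have Ple l m : leg_code l m i < n + 3 + k.+1.
  rewrite /leg_code; have := g_le (V l (n + 2)) i; have := ltn_ord l.
  by case: [&& _, _ & _] => /=; do ?[case: ifP => ?]; lia.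
by rewrite /code; case: ifP => // _; case: pickP.
Qed.

(** The first vertex of [leg_y] always becomes the end [y] of the modified edge; that of [leg_x]
    becomes [x] when the edge is deleted. *)
Definition leg_x : 'I_(n + 1) := lshift 1 d.
Definition leg_y : 'I_(n + 1) := rshift n ord0.

Lemma leg_yE : leg_y = n :> nat. Proof. exact: addn0. Qed.

(* The pair of vertices of [H] placed at the ends of the modified edge. *)
Definition exception : {set U} :=
  if D s then [set V leg_y 0; V leg_y 1] else [set V leg_x 1; V leg_y 1].

(** Labels must be distinct for every pair, but they need to reflect adjacency in [H] only off the
    exceptional pair, where the modified edge decides. *)
Definition faithful x y : Prop :=
  0 < hamming (code x) (code y) /\
  ([set x; y] != exception -> (hamming (code x) (code y) == 1) = adj H x y).

Lemma faithfulC x y : faithful x y -> faithful y x.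
Proof. by rewrite /faithful hammingC adj_sym [[set y; x]]setUC. Qed.

Lemma code_hamming l l' m m' : m <= n + 2 -> m' <= n + 2 ->
  hamming (code (V l m)) (code (V l' m')) = hamming (leg_code l m) (leg_code l' m').
Proof. by move=> mn m'n; apply: eq_hamming => i; rewrite !code_V. Qed.

Lemma faithful_leg l m m' : m < m' <= n + 2 -> faithful (V l m) (V l m').
Proof.
move=> mm'; have /andP[ltmm' m'n] := mm'; have mn : m <= n + 2 by lia.
rewrite /faithful code_hamming //; split; first exact: leg_code_gt0.
move=> exc; rewrite (so_adjV HV) // leg_code_adj //.
apply: contraNN exc => /and4P[Dss /eqP ln /eqP-> /eqP->].
by rewrite /exception Dss (_ : l = leg_y) //; apply: ord_inj; rewrite ln leg_yE.
Qed.

Lemma faithful_legF l m y :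
  m < n + 2 -> y \in vset F -> faithful (V l m) y.
Proof.
move=> mn yF; case: (eqVneq y (V l (n + 2))) => [->|/eqP yl].
  by apply: faithful_leg; lia.
have := leg_code_F mn yF yl.
rewrite /faithful (@eq_hamming _ _ _ (code _) _ (leg_code l m) (F_code y)).
  move=> h2; split; first lia.
  by rewrite gtn_eqF // (so_adjVF HV) // (introF eqP yl) andbF.
by move=> i; rewrite code_V ?code_F //; lia.
Qed.

Lemma faithful_cross l l' m m' : l != l' ->
  0 < m < n + 2 -> 0 < m' < n + 2 -> faithful (V l m) (V l' m').
Proof.
move=> ll' mn m'n; rewrite /faithful code_hamming; [|lia..].
rewrite (so_adjVV HV) //.
case: (boolP [&& ~~ D s, spiral l, spiral l', m == 1 & m' == 1]); last first.
  by move=> /(leg_code_cross ll' mn m'n) h2; split; [lia | rewrite gtn_eqF].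
case/and5P=> /negbTE nDs sl sl' /eqP-> /eqP->; split.
  apply: (@hamming_gt0 _ _ _ _ d); rewrite !leg_code_d /time_d sl sl' /=.
  have : l != l' :> nat by [].
  by rewrite (_ : 1 < n + 2) /=; lia.
have spiralE k' : spiral k' -> k' = leg_x \/ k' = leg_y.
  by case/orP=> /eqP E; [left|right]; apply: val_inj; rewrite /= ?addn0.
rewrite /exception nDs; case: (spiralE _ sl) ll' => ->; case: (spiralE _ sl') => ->;
  by rewrite ?eqxx // setUC eqxx.
Qed.

Lemma code_faithful x y :
  x \in vset H -> y \in vset H -> x <> y -> faithful x y.
Proof.
move=> /(so_vset HV)[xF|[l [m [mn ->]]]] /(so_vset HV)[yF|[l' [m' [m'n ->]]]] xy.
- rewrite /faithful !code_F // (so_adjF HV) //.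
  by have [? ->] := F_code_adj xF yF xy.
- exact/faithfulC/faithful_legF.
- exact: faithful_legF.
have same l1 m1 m2 : m1 < n + 2 -> m2 < n + 2 -> V l1 m1 <> V l1 m2 ->
    faithful (V l1 m1) (V l1 m2).
  move=> m1n m2n; case: (ltngtP m1 m2) => [lt|lt|->] // _.
    by apply: faithful_leg; lia.
  by apply/faithfulC/faithful_leg; lia.
case: (eqVneq l l') xy => [->|ll']; first exact: same.
case: (posnP m) => [->|m0]; first by rewrite (so_root HV l l'); apply: same; lia.
case: (posnP m') => [->|m'0]; first by rewrite (so_root HV l' l); apply: same; lia.
by move=> _; apply: faithful_cross; rewrite // ?m0 ?m'0.
Qed.

Lemma code_root l i : code (V l 0) i = 0.
Proof. by rewrite code_V ?leg_code_root. Qed.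

Lemma code_spiral1 l i : spiral l ->
  code (V l 1) i = if i == d then l + 2 else (l == n :> nat) && D i.
Proof.
move=> sl; rewrite code_V ?addn2 //; case: eqP => [->|/eqP id].
  by rewrite leg_code_d /time_d sl /= ifT //; lia.
rewrite leg_code_early //; first by have := t_bounds l id; lia.
by move=> _; rewrite /time_special sl.
Qed.

(** * From labels to points of the box *)

Section Embedding.
Variable p : 'I_n -> {perm 'I_(n + 3 + k).+1}.

(** Permuting the labels within each coordinate keeps Hamming distances; the freedom in [p] is used
    to send the exceptional pair to the given edge. *)
Definition point x : {ffun 'I_n -> 'I_(n + 3 + k).+1} :=
  [ffun i => p i (inord (code x i))].

Lemma point_hamming x y : hamming (point x) (point y) = hamming (code x) (code y).
Proof.
apply: eq_hamming => i; rewrite !ffunE (inj_eq perm_inj).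
by rewrite -val_eqE /= !inordK // -addnS code_le.
Qed.

Lemma point_inj : {in vset H &, injective point}.
Proof.
move=> x y xH yH E; apply/eqP; apply: contraTT isT => /eqP xy.
have [] := code_faithful xH yH xy; rewrite -point_hamming E lt0n cards_eq0.
by case/negP; apply/eqP/setP => i; rewrite !inE eqxx.
Qed.

Lemma point_set2 x y u v : x \in vset H -> y \in vset H ->
  u \in vset H -> v \in vset H ->
  ([set point x; point y] == [set point u; point v]) = ([set x; y] == [set u; v]).
Proof.
move=> xH yH uH vH; apply/eqP/eqP => /set2_eq[[]|[]].
- by move=> /(point_inj xH uH)-> /(point_inj yH vH)->.
- by move=> /(point_inj xH vH)-> /(point_inj yH uH)->; rewrite setUC.
- by move=> -> ->.
- by move=> -> ->; rewrite setUC.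
Qed.

(** [G] stands for the box with the exceptional pair corrected to match [H]; all other pairs are
    settled by [code_faithful]. *)
Lemma point_induced (G : graph {ffun 'I_n -> 'I_(n + 3 + k).+1}) :
  vset G = setT ->
  (forall x y, x \in vset H -> y \in vset H -> x <> y ->
     adj G (point x) (point y) =
     if [set x; y] == exception then adj H x y
     else hamming (point x) (point y) == 1) ->
  induced_in H G.
Proof.
move=> GT G_adj; apply: (induced_inP point_inj) => [x _|x y xH yH].
  by rewrite GT inE.
case: (x =P y) => [->|xy]; first by rewrite !adj_irr.
rewrite G_adj // point_hamming; case: ifP => // /negbT exc.
by have [_ ->] := code_faithful xH yH xy.
Qed.

End Embedding.

Lemma leg_vset l m : m < n + 2 -> V l m \in vset H.
Proof. by move=> mn; apply/(so_vset HV); right; exists l, m. Qed.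

End Codes.

(** * Changing an edge *)

Lemma adj_del_edge (U : finType) (G : graph U) e x y :
  adj (del_edge G e) x y = ([set x; y] != e) && adj G x y.
Proof. by rewrite /adj in_setD1. Qed.

Lemma adj_add_edge (U : finType) (G : graph U) e x y :
  e \in compl_eset G -> adj (add_edge G e) x y = ([set x; y] == e) || adj G x y.
Proof.
move=> eG; rewrite /adj !inE orbC; case: (eqVneq [set x; y] e) => //= ->.
by move: eG; rewrite !inE => ->.
Qed.

Lemma ord_neq n (i : 'I_n) : 1 < n -> exists j : 'I_n, j != i.
Proof.
move=> n1; case: (eqVneq i (Ordinal n1)) => [->|iE]; last first.
  by exists (Ordinal n1); rewrite eq_sym.
by exists (Ordinal (ltnW n1)).
Qed.

Lemma ord_neq2 n (i j : 'I_n) : 2 < n -> exists k : 'I_n, (k != i) && (k != j).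
Proof.
move=> n2; have /card_gt0P[k] : 0 < #|predC (pred2 i j)|.
  rewrite -(ltn_add2l #|pred2 i j|) cardC card_ord card2 addn0.
  by case: (i != j) => /=; lia.
by rewrite !inE negb_or; exists k.
Qed.

Section Saturation.
Variables (n k : nat) (U : finType) (H F : graph U).
Variable V : 'I_(n + 1) -> nat -> U.
Hypotheses (n3 : 3 <= n) (HV : spider_on H F V).
Hypothesis coords : forall d : 'I_n, exists g : U -> 'I_n -> nat,
  [/\ forall x i, g x i <= k, forall x, g x d = 0 &
      {in vset F &, forall x y, x <> y ->
        0 < hamming (g x) (g y) /\ (hamming (g x) (g y) == 1) = adj F x y}].

Notation box := (box n (n + 3 + k).+1).
Notation label c := (inord c : 'I_(n + 3 + k).+1).

Let label_inj c c' : c <= n + 3 -> c' <= n + 3 -> (label c == label c') = (c == c').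
Proof. by move=> cn c'n; rewrite -val_eqE /= !inordK //; lia. Qed.

Lemma induced_in_del_edge e :
  e \in eset box -> induced_in H (del_edge box e).
Proof.
case/imset2P=> x y _; rewrite inE => /andP[_ /hamming_eq1P[d xyd xyE]] eE.
have [s sd] : exists s, s != d by apply: ord_neq; lia.
have [g [g_le g_d g_adj]] := coords d.
(* [z] is coordinate [d] of the root, a third point on the line through [x] and [y]. *)
have [z /andP[zx zy]] : exists z, (z != x d) && (z != y d).
  by apply: ord_neq2; lia.
(* With [D] empty, the first vertices of legs [d] and [n] differ in coordinate [d] only, so their
   labels are adjacent although [H] has no such edge. *)
pose D : pred 'I_n := pred0; have Ds i : D i -> D s by [].
have pP i : exists q : {perm 'I_(n + 3 + k).+1},
    q (label 0) = (if i == d then z else x i) /\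
    (i = d -> q (label (d + 2)) = x d /\ q (label (n + 2)) = y d).
  have dn := ltn_ord d.
  case: (eqVneq i d) => [->|id].
    have [||q [q0 q1 q2]] := @perm_extension _
      [:: label 0; label (d + 2); label (n + 2)] [:: z; x d; y d] erefl => //=.
    - by rewrite !inE !label_inj //=; lia.
    - by rewrite !inE negb_or zx zy xyd.
    by exists q.
  have [||q [q0]] := @perm_extension _ [:: label 0] [:: x i] erefl => //.
  by exists q; split=> // id'; rewrite id' eqxx in id.
have [p p_spec] := fin_all_exists pP.
pose f := point F V d s D g p.
have spx : spiral d (leg_x d) by rewrite /spiral eqxx.
have spy : spiral d (leg_y n) by rewrite /spiral leg_yE eqxx orbT.
have fx : f (V (leg_x d) 1) = x.
  apply/ffunP => i; rewrite ffunE (code_spiral1 _ _ n3 HV sd) //= andbF.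
  have [p0 pd] := p_spec i; case: (eqVneq i d) p0 => [->|id] p0 //.
  exact: ((p_spec d).2 erefl).1.
have fy : f (V (leg_y n) 1) = y.
  apply/ffunP => i; rewrite ffunE (code_spiral1 _ _ n3 HV sd) // leg_yE andbF.
  have [p0 pd] := p_spec i; case: (eqVneq i d) p0 => [->|id] p0 //.
    exact: ((p_spec d).2 erefl).2.
  by rewrite p0 xyE.
have exE : exception V d s D = [set V (leg_x d) 1; V (leg_y n) 1] by [].
have V1 l : V l 1 \in vset H by apply: (leg_vset HV); lia.
apply: (point_induced n3 HV sd Ds g_le g_d g_adj (p := p)) => // u v uH vH uv.
rewrite adj_del_edge eE -fx -fy /f
  (point_set2 n3 HV sd Ds g_le g_d g_adj) // exE adj_box.
case: eqP => //= /set2_eq E.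
have nadj : adj H (V (leg_x d) 1) (V (leg_y n) 1) = false.
  apply: (so_adjVV HV); [|lia|lia].
  by rewrite -(inj_eq val_inj) /= addn0; have := ltn_ord d; lia.
by case: E => -[-> ->]; rewrite // adj_sym.
Qed.

Lemma induced_in_add_edge e :
  e \in compl_eset box -> induced_in H (add_edge box e).
Proof.
move=> e_c; move: (e_c); rewrite in_setD => /andP[e_n].
rewrite inE => /andP[_ /cards2P[x [y [xy eE]]]].
(* Distinct nonadjacent points differ in at least two coordinates, which supply [d] and [s]; in
   particular [D s] will hold. *)
have h1 : 1 < hamming x y.
  rewrite ltn_neqAle eq_sym -adj_box /adj -eE e_n /= card_gt0.
  apply: contraNneq xy => E; apply/eqP/ffunP => i; apply/eqP.
  by have := in_set0 i; rewrite -E inE => /negbFE.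
case/card_gt1P: h1 => d [s []]; rewrite !inE => xyd xys; rewrite eq_sym => sd.
have [g [g_le g_d g_adj]] := coords d.
pose D i := x i != y i; have Ds i : D i -> D s by [].
(* The root, labelled 0, goes to [x]. The first vertex of leg [n] has label [n + 2] in coordinate
   [d] and label [D i] elsewhere, and goes to [y]. *)
have pP i : exists q : {perm 'I_(n + 3 + k).+1},
    [/\ q (label 0) = x i, i = d -> q (label (n + 2)) = y i
      & i != d -> q (label (D i)) = y i].
  case: (eqVneq i d) => [->|id].
    have [||q [q0 q1]] := @perm_extension _
      [:: label 0; label (n + 2)] [:: x d; y d] erefl => //=.
    - by rewrite !inE !label_inj //=; lia.
    - by rewrite !inE xyd.
    by exists q.
  have ne : i = d -> False by move=> id'; rewrite id' eqxx in id.
  case: (boolP (D i)) => Di.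
    have [||q [q0 q1]] := @perm_extension _
      [:: label 0; label 1] [:: x i; y i] erefl => //=.
    - by rewrite !inE !label_inj //; lia.
    - by rewrite mem_seq1 andbT; exact: Di.
    by exists q; split=> // /ne.
  have [||q [q0]] := @perm_extension _ [:: label 0] [:: x i] erefl => //.
  exists q; split=> [//|/ne//|_]; apply: etrans q0 _.
  exact/eqP/negbNE.
have [p p_spec] := fin_all_exists pP.
pose f := point F V d s D g p.
have spy : spiral d (leg_y n) by rewrite /spiral leg_yE eqxx orbT.
have fx : f (V (leg_y n) 0) = x.
  by apply/ffunP => i; rewrite ffunE (code_root _ _ n3 HV sd) //; have [->] := p_spec i.
have fy : f (V (leg_y n) 1) = y.
  apply/ffunP => i; rewrite ffunE (code_spiral1 _ _ n3 HV sd) // leg_yE eqxx.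
  have [_ pd pD] := p_spec i; case: (eqVneq i d) => [id|//].
  exact: pd.
have exE : exception V d s D = [set V (leg_y n) 0; V (leg_y n) 1].
  by rewrite /exception (_ : D s).
have V0 : V (leg_y n) 0 \in vset H by apply: (leg_vset HV); lia.
have V1 : V (leg_y n) 1 \in vset H by apply: (leg_vset HV); lia.
apply: (point_induced n3 HV sd Ds g_le g_d g_adj (p := p)) => // u v uH vH uv.
rewrite adj_add_edge // eE -fx -fy /f
  (point_set2 n3 HV sd Ds g_le g_d g_adj) // exE adj_box.
case: eqP => //= /set2_eq E.
have isadj : adj H (V (leg_y n) 0) (V (leg_y n) 1) by rewrite (so_adjV HV) //; lia.
by case: E => -[-> ->]; rewrite ?isadj // adj_sym isadj.
Qed.

End Saturation.

Theorem theoremB (n : nat) (hn : 3 <= n) (U : finType) (H : graph U)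
    (hH : spider_class n H) :
  exists2 k : nat, 0 < k & induced_saturated H (box n k).
Proof.
have n0 : 0 < n by lia.
have [F [V [dimF HV]]] := spider_class_spider_on n0 hH.
have leafF : V (leg_y n) (n + 2) \in vset F by rewrite (so_leaf HV).
have [k coords] := dim_le_coords n0 leafF dimF.
(* Labels 0 to [n + 2] are for the root, the slice and the legs; the coordinates of [F], at most
   [k], are shifted by [n + 3]. *)
exists (n + 3 + k).+1 => //; split.
- pose c b : {ffun 'I_n -> 'I_(n + 3 + k).+1} := [ffun=> inord b].
  apply/card_gt1P; exists (c 0), (c 1); split; rewrite ?inE //.
  apply/eqP => /ffunP/(_ (Ordinal n0)); rewrite !ffunE => /(congr1 val).
  by rewrite /= !inordK //; lia.
- exact: not_induced_in_box n0 HV.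
- exact: induced_in_del_edge hn HV coords.
- exact: induced_in_add_edge hn HV coords.
Qed.
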